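(* The two-fault re-rooting guarantee does not generally extend to three faulty nodes. That is, the following assertion is false: for every integer $k\ge 1$ and any three faulty nodes $F_1,F_2,F_3$ of the dense Gaussian network $G_k=G(k+(k+1)i)$ there exists a node $NS$ of $G_k$ with $d(F_1,NS)=d(F_2,NS)=d(F_3,NS)=k$.
   Context: For an integer $k\ge 1$ put $\pi=k+(k+1)i\in\mathbb{Z}[i]$. The dense Gaussian network $G_k=G(\pi)$ is the undirected graph whose vertex (node) set is the set of residue classes $\mathbb{Z}[i]_\pi=\mathbb{Z}[i]/(\pi)$, and in which two vertices $\alpha,\beta$ are adjacent if and only if $\beta-\alpha\equiv \pm1$ or $\pm i \pmod \pi$. It has $k^2+(k+1)^2$ nodes. The distance $d(u,v)$ is the graph distance, i.e. the minimum number of edges on a path joining $u$ and $v$; the diameter of $G_k$ is $k$. A ''faulty node'' is simply a designated node of $G_k$; three faulty nodes means three distinct nodes. The ''two-fault re-rooting guarantee'' is the statement that for any two faulty nodes $F_1,F_2$ of $G_k$ there exists a node $NS$ of $G_k$ (the re-rooted source) such that $d(F_1,NS)=k$ and $d(F_2,NS)=k$. *)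

(* Defs.v *)
From HB Require Import structures.
From mathcomp Require Import all_boot all_order all_algebra.
From mathcomp Require Import generic_quotient ring_quotient boolp ring.

Set Implicit Arguments.
Unset Strict Implicit.
Unset Printing Implicit Defensive.

Import GRing.Theory.
Local Open Scope ring_scope.
Local Open Scope quotient_scope.

Record gaussInt : Type := Gauss { gRe : int; gIm : int }.

Definition pair_of_gauss (x : gaussInt) : int * int := (gRe x, gIm x).
Definition gauss_of_pair (p : int * int) : gaussInt := Gauss p.1 p.2.

Lemma pair_of_gaussK : cancel pair_of_gauss gauss_of_pair.
Proof. by case. Qed.

HB.instance Definition _ := Countable.copy gaussInt (can_type pair_of_gaussK).

Definition gadd (x y : gaussInt) := Gauss (gRe x + gRe y) (gIm x + gIm y).
Definition gopp (x : gaussInt) := Gauss (- gRe x) (- gIm x).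
Definition gmul (x y : gaussInt) :=
  Gauss (gRe x * gRe y - gIm x * gIm y) (gRe x * gIm y + gIm x * gRe y).

Fact gaddA : associative gadd.
Proof. by move=> [a b] [c d] [e f]; congr Gauss => /=; ring. Qed.
Fact gaddC : commutative gadd.
Proof. by move=> [a b] [c d]; congr Gauss => /=; ring. Qed.
Fact gadd0 : left_id (Gauss 0 0) gadd.
Proof. by move=> [a b]; congr Gauss => /=; ring. Qed.
Fact gaddN : left_inverse (Gauss 0 0) gopp gadd.
Proof. by move=> [a b]; congr Gauss => /=; ring. Qed.
HB.instance Definition _ :=
  GRing.isZmodule.Build gaussInt gaddA gaddC gadd0 gaddN.

Fact gmulA : associative gmul.
Proof. by move=> [a b] [c d] [e f]; congr Gauss => /=; ring. Qed.
Fact gmulC : commutative gmul.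
Proof. by move=> [a b] [c d]; congr Gauss => /=; ring. Qed.
Fact gmul1 : left_id (Gauss 1 0) gmul.
Proof. by move=> [a b]; congr Gauss => /=; ring. Qed.
Fact gmulDl : left_distributive gmul gadd.
Proof. by move=> [a b] [c d] [e f]; congr Gauss => /=; ring. Qed.
Fact gone_neq0 : Gauss 1 0 != 0.
Proof. by []. Qed.
HB.instance Definition _ :=
  GRing.Zmodule_isComNzRing.Build gaussInt gmulA gmulC gmul1 gmulDl gone_neq0.

Definition gi : gaussInt := Gauss 0 1.

Definition gpi (k : nat) : gaussInt := k%:R + k.+1%:R * gi.

Definition gpi_ideal (k : nat) : {pred gaussInt} :=
  [pred x | `[< exists q : gaussInt, x = q * gpi k >]].

Fact gpi_ideal_zmod_closed k : zmod_closed (gpi_ideal k).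
Proof.
split=> [|x y /asboolP[p ->] /asboolP[q ->]]; apply/asboolP.
  by exists 0; rewrite mul0r.
by exists (p - q); rewrite mulrBl.
Qed.
HB.instance Definition _ k :=
  GRing.isZmodClosed.Build gaussInt (gpi_ideal k) (gpi_ideal_zmod_closed k).

(* Only the additive structure of Z[i]/(pi) is used: MathComp equips
   {ideal_quot I} with a ring structure for proper ideals I only, and for
   k = 0 the generator is a unit. *)
Definition node (k : nat) := {ideal_quot (gpi_ideal k)}.

Definition residue (k : nat) (x : gaussInt) : node k := \pi_(node k) x.

Definition adj (k : nat) : rel (node k) := fun u v =>
  v - u \in [:: residue k 1; residue k (- 1); residue k gi; residue k (- gi)].

(* The paths p may repeat nodes: this does not change the minimal length. *)
Definition joined_by (k : nat) (u v : node k) (n : nat) : bool :=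
  `[< exists p : seq (node k),
        [/\ path (@adj k) u p, last u p = v & size p = n] >].

Lemma residueD k : {morph @residue k : x y / x + y}.
Proof. by move=> x y; apply: raddfD. Qed.

Lemma residueN k : {morph @residue k : x / - x}.
Proof. by move=> x; apply: raddfN. Qed.

Lemma residue_eqP k (x y : gaussInt) :
  residue k x = residue k y <-> exists q, x - y = q * gpi k.
Proof.
rewrite (rwP eqP) -[_ == _](Quotient.idealrBE (gpi_ideal k)).
by split=> /asboolP.
Qed.

Lemma residue_surj k (u : node k) : exists x, u = residue k x.
Proof. by exists (repr u); rewrite /residue reprK. Qed.

Lemma joined_byxx k (u : node k) : joined_by u u 0.
Proof. by apply/asboolP; exists [::]. Qed.

Lemma joined_by_trans k (u v w : node k) m n :
  joined_by u v m -> joined_by v w n -> joined_by u w (m + n).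
Proof.
move=> /asboolP[p [pu pv <-]] /asboolP[q [qv qw <-]]; apply/asboolP.
by exists (p ++ q); rewrite cat_path last_cat size_cat pv pu qv qw.
Qed.

Lemma joined_by1 k (u v : node k) : adj u v -> joined_by u v 1.
Proof. by move=> uv; apply/asboolP; exists [:: v]; rewrite /= uv. Qed.

Lemma joined_byMn k (u : node k) (e : gaussInt) m :
  e \in [:: 1; - 1; gi; - gi] -> joined_by u (u + residue k (e *+ m)) m.
Proof.
move=> he; elim: m => [|m IHm].
  by rewrite mulr0n [residue k 0]raddf0 addr0; apply: joined_byxx.
rewrite -addn1; apply: (joined_by_trans IHm); apply: joined_by1.
rewrite /adj addn1 mulrSr residueD addrA [_ + residue k e]addrC addrK.
by move: he; rewrite !inE => /or4P[] /eqP->; rewrite eqxx ?orbT.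
Qed.

Lemma joined_byMz k (u : node k) (e : gaussInt) (a : int) :
  e \in [:: 1; gi] -> exists m, joined_by u (u + residue k (e *~ a)) m.
Proof.
move=> he; exists (absz a); case: a => n.
  apply: joined_byMn; move: he.
  by rewrite !inE => /orP[] ->; rewrite ?orbT.
rewrite NegzE mulrNz -mulNrz -pmulrn; apply: joined_byMn; move: he.
by rewrite !inE => /orP[] /eqP->; rewrite eqxx ?orbT.
Qed.

Lemma gauss_intmul (x : gaussInt) : x = 1 *~ gRe x + gi *~ gIm x.
Proof.
have E (e : gaussInt) (n : nat) : e *+ n = Gauss (gRe e *+ n) (gIm e *+ n).
  by elim: n => // n IHn; rewrite !mulrS IHn.
have F (e : gaussInt) (a : int) : e *~ a = Gauss (gRe e * a) (gIm e * a).
  by case: a => n; rewrite ?NegzE -!mulrzz ?mulrNz -!pmulrn E.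
by case: x => a b; rewrite !F; congr Gauss => /=; ring.
Qed.

Lemma connected k (u v : node k) : exists n, joined_by u v n.
Proof.
have [x vu] := residue_surj (v - u).
have [m Hm] := @joined_byMz k u 1 (gRe x) isT.
have [n Hn] := @joined_byMz k (u + residue k (1 *~ gRe x)) gi (gIm x) isT.
exists (m + n)%N; apply: joined_by_trans Hm _; move: Hn.
by rewrite -addrA -residueD -gauss_intmul -vu addrC subrK.
Qed.

Definition dist (k : nat) (u v : node k) : nat := ex_minn (connected u v).

(* Main.v *)
(** For k = 3 the network has 25 nodes, and x + yi |-> x + 18 y identifies it
    with Z/25.  The faults 0, 2 and -2 are a counterexample: the three balls of
    radius 2 centred at them cover all 25 nodes, so no node is at distance 3
    from each of them. *)

Require Import Defs.
From mathcomp Require Import all_boot.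
From mathcomp Require Import ssralg ssrint intdiv ring_quotient zify.

Set Implicit Arguments.
Unset Strict Implicit.

Import GRing.Theory.

Section FaultBalls.
Local Open Scope ring_scope.

Lemma dist_le k (u v : node k) n : joined_by u v n -> (dist u v <= n)%N.
Proof. by rewrite /dist; case: ex_minnP => m _ Hm /Hm. Qed.

Lemma joined_by_absz k (u : node k) (e : gaussInt) (a : int) : e \in [:: 1; gi] ->
  joined_by u (u + residue k (e *~ a)) `|a|%N.
Proof.
move=> he; case: a => n.
  by apply: joined_byMn; move: he; rewrite !inE => /orP[] ->; rewrite ?orbT.
rewrite NegzE mulrNz -mulNrz -pmulrn; apply: joined_byMn; move: he.
by rewrite !inE => /orP[] /eqP->; rewrite eqxx ?orbT.
Qed.

(** A horizontal walk followed by a vertical one. *)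
Lemma dist_add_le k (u : node k) (x : gaussInt) :
  (dist u (u + residue k x)%R <= `|gRe x| + `|gIm x|)%N.
Proof.
rewrite [in residue k x](gauss_intmul x) residueD addrA.
by apply/dist_le/joined_by_trans; apply: joined_by_absz; rewrite !inE eqxx ?orbT.
Qed.

(* As 18^2 + 1 = 13 * 25 and 3 + 4 * 18 = 3 * 25, the ideal (3 + 4i) is the
   kernel of x + yi |-> x + 18 y modulo 25; the quotient is read off
   (x + yi)(3 - 4i) / 25. *)
Lemma residue3_eq (x y : gaussInt) (m : int) :
  gRe x + 18 * gIm x = gRe y + 18 * gIm y + 25 * m ->
  residue 3 x = residue 3 y.
Proof.
case: x y => [a b] [c d] /= E; apply/residue_eqP.
exists (Gauss (3 * m - 2 * (b - d)) (3 * (b - d) - 4 * m)).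
have -> : gpi 3 = Gauss 3 4 by [].
have -> : Gauss a b - Gauss c d = Gauss (a - c) (b - d) by [].
by rewrite [RHS]/(gmul _ _) /gmul /=; congr Gauss; lia.
Qed.

Lemma residue3_int_inj (a b : int) :
  residue 3 (Gauss a 0) = residue 3 (Gauss b 0) -> (25 %| a - b)%Z.
Proof.
case/residue_eqP=> -[c d].
have -> : gpi 3 = Gauss 3 4 by [].
(* The vanishing imaginary part [c * 4 + d * 3] forces [c = 3t] and [d = -4t], so [a - b = 25t] with
   [t = -(c + d)]. *)
move=> E; apply/dvdzP; exists (- (c + d)).
have E1 : a - b = c * 3 - d * 4 := congr1 gRe E.
have E2 : 0 = c * 4 + d * 3 := congr1 gIm E.
by lia.
Qed.

Definition faults : seq int := [:: 0; 2; -2].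

Definition coords : seq int := [:: 0; 1; -1; 2; -2].

(** The covering by the three balls, transported to Z/25 and checked residue by residue. *)
Lemma balls_cover : all (fun r : nat =>
  has (fun f => has (fun c => has (fun d : int =>
     (`|c| + `|d| < 3)%N && (25 %| r%:Z - (f + c + 18 * d))%Z)
   coords) coords) faults) (iota 0 25).
Proof. by vm_compute. Qed.

Lemma near_fault (v : node 3) :
  exists2 f, f \in faults & (dist (residue 3 (Gauss f 0)) v < 3)%N.
Proof.
have [x ->] := residue_surj v; pose t := gRe x + 18 * gIm x.
have Hr : `|(t %% 25)%Z|%N \in iota 0 25 by rewrite mem_iota; lia.
have /hasP[f hf /hasP[c _ /hasP[d _ /andP[cd3 /dvdzP[q Hq]]]]] :=
  allP balls_cover _ Hr.
exists f => //; apply: leq_ltn_trans cd3.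
suff -> : residue 3 x = residue 3 (Gauss f 0) + residue 3 (Gauss c d).
  exact: dist_add_le.
have -> : residue 3 (Gauss f 0) + residue 3 (Gauss c d)
        = residue 3 (Gauss (f + c) d).
  by rewrite -residueD; congr (residue 3 (Gauss _ _)); rewrite /= add0r.
(* Here [t = 25 * (t %/ 25) + r] and [r = f + c + 18 * d + 25 * q]. *)
apply: (@residue3_eq _ _ ((t %/ 25)%Z + q)); rewrite -/t /=.
by have := divz_eq t 25; lia.
Qed.

End FaultBalls.

Theorem proposition1 :
  ~ (forall k : nat, 1 <= k ->
     forall F1 F2 F3 : node k, F1 <> F2 -> F1 <> F3 -> F2 <> F3 ->
     exists NS : node k, dist F1 NS = k /\ dist F2 NS = k /\ dist F3 NS = k).
Proof.
move=> /(_ 3 isT (residue 3 (Gauss 0 0)) (residue 3 (Gauss 2 0))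
  (residue 3 (Gauss (-2)%R 0))).
(* The faults are distinct: 25 divides none of the differences -2, 2 and 4. *)
case; try by move/residue3_int_inj.
move=> v [d0 [d2 dN2]]; have [f] := near_fault v.
(* Whichever fault is near, its distance 3 to [v] would be below 3. *)
by rewrite !inE => /or3P[] /eqP->; rewrite ?d0 ?d2 ?dN2.
Qed.
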